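(* Let $X$ be a Banach space. A maximal monotone multifunction $T:X\rightrightarrows X^*$ is regular if and only if it satisfies the following condition: for every nonempty, convex, $w(X^*,X)$-compact set $C\subset X^*$ and every $x_0\in X$, if for every $(y,y^* )\in G(T)$ there exists $x^*\in C$ (depending on $(y,y^* )$) such that $\langle y^*-x^*,y-x_0\rangle\ge 0$, then there exists $x_0^*\in C$ such that $x_0^*\in T(x_0)$.
   Context: $X$ is a (real) Banach space with topological dual $X^*$ and $\langle x^*,x\rangle=\langle x,x^*\rangle$ denotes the evaluation pairing; $w(X^*,X)$ is the weak$^*$ topology on $X^*$. For a multifunction $T:X\rightrightarrows X^*$, its graph is $G(T)=\{(x,x^* )\in X\times X^*: x^*\in T(x)\}$. $T$ is monotone if $\langle x^*-y^*,x-y\rangle\ge 0$ for all $(x,x^* ),(y,y^* )\in G(T)$; it is maximal monotone if it is monotone and there is no monotone multifunction $S:X\rightrightarrows X^*$ whose graph strictly contains $G(T)$. For $(x,x^* )\in X\times X^*$ put $$L(x,x^*,T)=\max\left\{0,\ \sup\left\{\frac{\langle x^*-y^*,y-x\rangle}{\|x-y\|}: (y,y^* )\in G(T),\ y\neq x\right\}\right\}\in[0,\infty],$$ and $d(x^*,T(x))=\inf\{\|y^*-x^*\|: y^*\in T(x)\}$, with $d(x^*,\emptyset)=\infty$. A maximal monotone multifunction $T$ is called regular if $L(x,x^*,T)=d(x^*,T(x))$ for every $(x,x^* )\in X\times X^*$. *)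

(* Defs.v *)
From HB Require Import structures.
From mathcomp Require Import all_boot all_order all_algebra.
From mathcomp Require Import all_classical all_reals all_analysis.
Import Order.TTheory GRing.Theory Num.Theory.
Import numFieldNormedType.Exports.

Set Implicit Arguments.
Unset Strict Implicit.
Unset Printing Implicit Defensive.

Local Open Scope classical_set_scope.
Local Open Scope ring_scope.

Section dual.
Variables (R : realType) (X : normedModType R).

Definition dual_pred : {pred X -> R^o} :=
  [pred f : X -> R^o | `[< linear f /\ continuous f >]].

(* The topological dual X^*, as a subtype of the functions X -> R; the pairing
   <f, x> is the application f x. *)
Record dual := Dual { dual_fun :> X -> R^o ; _ : dual_fun \in dual_pred }.

HB.instance Definition _ := [isSub for dual_fun].
HB.instance Definition _ := [Choice of dual by <:].

Lemma dual_predP (f : X -> R^o) :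
  f \in dual_pred <-> linear f /\ continuous f.
Proof. by split=> [/asboolP|fP]; last exact/asboolP. Qed.

Lemma dual_submod_closed : submod_closed dual_pred.
Proof.
split=> [|a f g].
  apply/dual_predP; split; last by move=> x; exact: cst_continuous.
  by move=> a x y; rewrite scaler0 addr0.
move=> /dual_predP[lf cf] /dual_predP[lg cg]; apply/dual_predP; split.
  move=> b x y; rewrite !fctE lf lg !scalerDr !scalerA (mulrC a b).
  by rewrite addrACA.
move=> x; apply: continuousD; last exact: cg.
by apply: continuousZl_tmp; exact: cf.
Qed.

HB.instance Definition _ :=
  GRing.isSubmodClosed.Build R (X -> R^o) dual_pred dual_submod_closed.
HB.instance Definition _ := [SubChoice_isSubLmodule of dual by <:].

(* The alias of [dual] carrying w(X^*, X), the coarsest topology making all the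
   evaluations f |-> f x continuous, i.e., the one induced by pointwise
   convergence. *)
Definition weak_star_dual : Type :=
  initial_topology (fun f : dual => (f : {ptws X -> R^o})).

HB.instance Definition _ := Topological.on weak_star_dual.

(* The dual norm; it is finite on [dual] since its elements are continuous. *)
Definition dual_norm (f : dual) : \bar R :=
  ereal_sup [set (`|f x|)%:E | x in [set x : X | `|x| <= 1]].

(* d(x^*, A) in the dual norm; it is +oo when A is empty. *)
Definition dual_dist (xs : dual) (A : set dual) : \bar R :=
  ereal_inf [set dual_norm (ys - xs) | ys in A].

Implicit Types T S : X -> set dual.

Definition graph T : set (X * dual) := [set p | T p.1 p.2].

Definition monotone T :=
  forall x xs y ys, graph T (x, xs) -> graph T (y, ys) ->
    0 <= (xs - ys) (x - y).

Definition maximal_monotone T :=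
  monotone T /\ ~ exists S, monotone S /\ graph T `<` graph S.

(* The supremum is -oo when its index set is empty. *)
Definition monotone_gap (x : X) (xs : dual) T : \bar R :=
  maxe 0%E (ereal_sup [set ((xs - p.2) (p.1 - x) / `|x - p.1|)%:E |
                       p in graph T `&` [set p | p.1 != x]]).

Definition regular_multifunction T :=
  forall x xs, monotone_gap x xs T = dual_dist xs (T x).

End dual.

(* Main.v *)
(* Functionals are primed, and [L(x, x')] stands for [L(x, x', T)].

   If the condition holds and [L(x, x')] is finite, apply it to the dual ball of
   centre [x'] and radius [L(x, x')], which is weak-star compact by
   Banach-Alaoglu; Hahn-Banach provides the point of the ball required for each
   point of the graph. The other half of regularity is monotonicity.

   Conversely, let [T] be regular and let [C], [x0] be as in the condition. By
   maximality it suffices to find [c] in [C] with [<y' - c, y - x0> >= 0] on all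
   of [G(T)], and by compactness only finitely many points [(y_i, y_i')] matter.
   If there is no such [c], some convex combination gives
   [A := sum p_i <y_i', y_i - x0> < min_C <c, yb>], [yb := sum p_i (y_i - x0)].
   For a small [t > 0], regularity yields points [(z, z')] of [G(T)] with [z]
   arbitrarily close to [x0 + t yb] and [<z', z - x0 - t yb> <= 0]: otherwise
   [T(x0 + t yb)] would be empty while [L(x0 + t yb, 0)] is finite.
   Monotonicity against the [(y_i, y_i')] then gives
   [<z', z - x0> <= t A + O(t^2)], which is smaller than [min_C <c, z - x0>] for
   [t] small. *)
Require Import Defs.
From HB Require Import structures.
From mathcomp Require Import all_boot all_order all_algebra.
From mathcomp Require Import all_classical all_reals all_analysis.
From mathcomp Require Import ring lra.
Import Order.TTheory GRing.Theory Num.Theory.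
Import numFieldNormedType.Exports.

Set Implicit Arguments.
Unset Strict Implicit.
Unset Printing Implicit Defensive.

Local Open Scope classical_set_scope.
Local Open Scope ring_scope.

(** * The Hahn-Banach theorem, by minimal sublinear functionals *)

Section hahn_banach.
Variables (R : realType) (V : lmodType R).
Implicit Types (p q : V -> R) (x y a : V).

Definition sublinear q :=
  (forall x y, q (x + y) <= q x + q y) /\
  (forall t x, 0 <= t -> q (t *: x) <= t * q x).

Lemma sublinearZ q t x : sublinear q -> 0 <= t -> q (t *: x) = t * q x.
Proof.
move=> [qD qZ]; rewrite le_eqVlt => /predU1P[<-|t0].
  apply/eqP; rewrite eq_le qZ//= scale0r mul0r.
  by have := qD 0 0; rewrite addr0; lra.
apply/eqP; rewrite eq_le qZ ?(ltW t0)//=.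
rewrite -ler_pdivlMl//; have := qZ t^-1 (t *: x).
by rewrite scalerA mulVf ?gt_eqF// scale1r; apply; rewrite invr_ge0 ltW.
Qed.

Lemma sublinear0 q : sublinear q -> q 0 = 0.
Proof. by move=> sq; rewrite -(scale0r (0 : V)) sublinearZ// mul0r. Qed.

Lemma sublinear_geN q x : sublinear q -> - q (- x) <= q x.
Proof.
move=> sq; have := sq.1 x (- x).
by rewrite subrr (sublinear0 sq); lra.
Qed.

(** For sublinear [q], this lowers [q] to a sublinear functional that is at most [- q a] at [- a]; a
    linear functional below it is thus at least [q a] at [a]. *)
Definition directional_inf q a x :=
  inf [set q (x + t *: a) - t * q a | t in [set t | 0 <= t]].

Lemma directional_inf_le q a x t : sublinear q -> 0 <= t ->
  directional_inf q a x <= q (x + t *: a) - t * q a.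
Proof.
move=> sq t0; apply: ge_inf; last by exists t.
(* The infimum is finite: apply subadditivity to [s *: a = (x + s *: a) - x]. *)
exists (- q (- x)) => _ [s s0 <-].
have := sq.1 (x + s *: a) (- x); rewrite addrAC subrr add0r sublinearZ//; lra.
Qed.

Lemma directional_inf_ge q a x m :
  (forall t, 0 <= t -> m <= q (x + t *: a) - t * q a) ->
  m <= directional_inf q a x.
Proof.
move=> h; apply: lb_le_inf; first by exists (q (x + 0 *: a) - 0 * q a), 0 => /=.
by move=> _ [s s0 <-]; exact: h.
Qed.

Lemma sublinear_directional_inf q a :
  sublinear q -> sublinear (directional_inf q a).
Proof.
move=> sq; split=> [x y|l x].
  rewrite -lerBlDr; apply: directional_inf_ge => t t0.
  rewrite lerBlDr -lerBlDl; apply: directional_inf_ge => s s0.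
  have := directional_inf_le a (x + y) sq (addr_ge0 t0 s0).
  have := sq.1 (x + t *: a) (y + s *: a).
  rewrite addrACA -scalerDl; lra.
rewrite le_eqVlt => /predU1P[<-|l0].
  rewrite scale0r mul0r; have := directional_inf_le a 0 sq (lexx 0).
  by rewrite scale0r addr0 (sublinear0 sq); lra.
rewrite -ler_pdivrMl//; apply: directional_inf_ge => t t0.
rewrite ler_pdivrMl//; have := directional_inf_le a (l *: x) sq
  (mulr_ge0 (ltW l0) t0).
by rewrite -scalerA -scalerDr (sublinearZ _ sq) ?(ltW l0)//; lra.
Qed.

Lemma directional_inf_le_id q a x : sublinear q -> directional_inf q a x <= q x.
Proof.
move=> sq; have := directional_inf_le a x sq (lexx 0).
by rewrite scale0r addr0 mul0r subr0.
Qed.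

(** Zorn's lemma for the reversed pointwise order on sublinear minorants of [p]. *)
Lemma exists_minimal_sublinear p : sublinear p ->
  exists q, [/\ sublinear q, forall x, q x <= p x &
    forall r, sublinear r -> (forall x, r x <= q x) -> r = q].
Proof.
move=> sp; pose T := {q : V -> R | sublinear q /\ forall x, q x <= p x}.
pose le (q r : T) := `[< forall x, sval r x <= sval q x >].
have [||||[q [sq qp]] qmin] := @Zorn T le.
- by move=> q; apply/asboolP.
- move=> q r s /asboolP qr /asboolP rs; apply/asboolP => x.
  exact: le_trans (rs x) (qr x).
- move=> [q hq] [r hr] /asboolP /= qr /asboolP /= rq; apply: eq_exist.
  by apply/funext => x; apply/eqP; rewrite eq_le qr rq.
- move=> A Atot; have [[q0 Aq0]|A0] := pselect (A !=set0); last first.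
    have hp : sublinear p /\ forall x, p x <= p x by [].
    by exists (exist _ p hp) => s As; exfalso; apply: A0; exists s.
  (* The pointwise infimum bounds the chain: it is finite since members are at least [- p (- x)] at
     [x], and subadditive since of two members one lies below the other. *)
  pose g x := inf [set sval q x | q in A].
  have gle (q : T) x : A q -> g x <= sval q x.
    move=> Aq; apply: ge_inf; last by exists q.
    exists (- p (- x)) => _ [r _ <-]; have [sr rp] := svalP r.
    by apply: le_trans (sublinear_geN x sr); rewrite lerN2.
  have gge m x : (forall q : T, A q -> m <= sval q x) -> m <= g x.
    move=> h; apply: lb_le_inf; first by exists (sval q0 x), q0.
    by move=> _ [q Aq <-]; exact: h.
  have hg : sublinear g /\ forall x, g x <= p x.
    split; last by move=> x; exact: le_trans (gle _ x Aq0) ((svalP q0).2 x).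
    split=> [x y|t x t0].
      rewrite -lerBlDr; apply: (gge) => q Aq.
      rewrite lerBlDr -lerBlDl; apply: (gge) => r Ar.
      rewrite lerBlDr; have [/asboolP|/asboolP] := Atot _ _ Aq Ar => h.
        apply: le_trans (gle r _ Ar) _; apply: le_trans ((svalP r).1.1 x y) _.
        by rewrite addrC lerD2l.
      apply: le_trans (gle q _ Aq) _; apply: le_trans ((svalP q).1.1 x y) _.
      by rewrite addrC lerD2r.
    move: t0; rewrite le_eqVlt => /predU1P[<-|t0].
      rewrite scale0r mul0r; apply: le_trans (gle _ _ Aq0) _.
      by rewrite (sublinear0 (svalP q0).1).
    rewrite -ler_pdivrMl//; apply: (gge) => q Aq; rewrite ler_pdivrMl//.
    rewrite -(sublinearZ _ (svalP q).1) ?(ltW t0)//; exact: gle.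
  by exists (exist _ g hg) => q Aq; apply/asboolP => x; exact: gle.
exists q; split=> // r sr rq.
have hr : sublinear r /\ forall x, r x <= p x.
  by split=> // x; exact: le_trans (rq x) (qp x).
have : exist _ r hr = exist _ q (conj sq qp) :> T by apply: qmin; apply/asboolP.
by move=> /(congr1 sval).
Qed.

(* Minimality of [q] forces [directional_inf q a = q], which reads
   [q (- a) = - q a] at [- a]. *)
Lemma minimal_sublinear_linear q : sublinear q ->
  (forall r, sublinear r -> (forall x, r x <= q x) -> r = q) ->
  linear (q : V -> R^o).
Proof.
move=> sq qmin.
have qN a : q (- a) = - q a.
  apply/eqP; rewrite eq_le; apply/andP; split; last first.
    by have := sublinear_geN (- a) sq; rewrite opprK.
  have e : directional_inf q a = q.
    apply: qmin; first exact: sublinear_directional_inf.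
    by move=> x; exact: directional_inf_le_id.
  have := directional_inf_le a (- a) sq ler01; rewrite e scale1r addNr mul1r.
  by rewrite (sublinear0 sq); lra.
have qD x y : q (x + y) = q x + q y.
  apply/eqP; rewrite eq_le sq.1/=; have := sq.1 (x + y) (- y).
  by rewrite addrK qN; lra.
move=> t x y; rewrite qD; congr (_ + _).
have [t0|t0] := leP 0 t; first exact: sublinearZ.
rewrite -[t *: x]opprK qN -scaleNr sublinearZ ?oppr_ge0 ?ltW//.
by rewrite mulNr opprK.
Qed.

(** A minimal functional below [directional_inf p v] is linear; being at most [- p v] at [- v], it
    attains [p v] at [v]. *)
Lemma hahn_banach p v : sublinear p ->
  exists f : V -> R^o, [/\ linear f, forall x, f x <= p x & f v = p v].
Proof.
move=> sp; have [f [sf fp fmin]] :=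
  exists_minimal_sublinear (sublinear_directional_inf v sp).
have lf := minimal_sublinear_linear sf fmin.
have fle x : f x <= p x.
  exact: le_trans (fp x) (directional_inf_le_id v x sp).
exists f; split=> //; apply/eqP; rewrite eq_le fle/=.
have := le_trans (fp (- v)) (directional_inf_le v (- v) sp ler01).
rewrite scale1r addNr mul1r (sublinear0 sp).
have := lf (-1) v 0; rewrite scaleN1r addr0 /GRing.scale/= => ->.
by rewrite (sublinear0 sf); lra.
Qed.

End hahn_banach.

(** * The dual space and weak-star compactness of balls *)

Section dual_theory.
Variables (R : realType) (X : normedModType R).
Implicit Types (f g : dual X) (x y : X).

Lemma dual_linear f : linear (f : X -> R^o).
Proof. by case: f => f /= /dual_predP[]. Qed.

HB.instance Definition _ f :=
  GRing.isLinear.Build R X R^o *:%R (dual_fun f) (dual_linear f).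

Lemma dual_continuous f : continuous (f : X -> R^o).
Proof. by case: f => f /= /dual_predP[]. Qed.

Lemma dualD f g x : (f + g) x = f x + g x. Proof. by []. Qed.

Lemma dualB f g x : (f - g) x = f x - g x. Proof. by []. Qed.

Lemma dualZ a f x : (a *: f) x = a * f x. Proof. by []. Qed.

Lemma dual_app0 f : f 0 = 0. Proof. exact: (linear0 f). Qed.

Lemma dual_appD f x y : f (x + y) = f x + f y. Proof. exact: (linearD f). Qed.

Lemma dual_appN f x : f (- x) = - f x. Proof. exact: (linearN f). Qed.

Lemma dual_appB f x y : f (x - y) = f x - f y. Proof. exact: (linearB f). Qed.

Lemma dual_appZ a f x : f (a *: x) = a * f x. Proof. exact: (linearZ_LR f). Qed.

Lemma exists_dual (f : X -> R^o) (k : R) : linear f ->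
  (forall x, `|f x| <= k * `|x|) -> exists g : dual X, g =1 f.
Proof.
move=> lf fk; pose F : {linear X -> R^o} :=
  HB.pack f (GRing.isLinear.Build _ _ _ _ _ lf).
have cf : continuous F.
  apply/linear_bounded_continuous/linear_boundedP.
  exists k; split; first exact: num_real.
  move=> r kr x; apply: le_trans (fk x) _.
  by rewrite ler_wpM2r// ltW.
have fP : f \in @dual_pred R X by apply/dual_predP.
by exists (Dual fP).
Qed.

Lemma dual_bounded f : exists k, forall x, `|f x| <= k * `|x|.
Proof.
have /linear_bounded_continuous/linear_boundedP[k [_ hk]] := @dual_continuous f.
by exists (k + 1); apply: hk; rewrite ltrDl.
Qed.

Lemma hahn_banach_support x :
  exists f : dual X, (forall y, `|f y| <= `|y|) /\ f x = `|x|.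
Proof.
have sn : sublinear (fun x : X => `|x|).
  split; first exact: ler_normD.
  by move=> t y t0; rewrite normrZ ger0_norm.
have [f [lf fn fx]] := hahn_banach x sn.
pose F : {linear X -> R^o} := HB.pack f (GRing.isLinear.Build _ _ _ _ _ lf).
have fN y : f (- y) = - f y by exact: (linearN F).
have fle y : `|f y| <= 1 * `|y|.
  by rewrite mul1r ler_norml fn andbT lerNl -fN (le_trans (fn _))// normrN.
have [g gf] := exists_dual lf fle.
by exists g; split => [y|]; rewrite gf ?fx// -[leRHS]mul1r.
Qed.

Lemma dual_norm_le f (k : R) : 0 <= k ->
  (forall x, `|f x| <= k * `|x|) -> (dual_norm f <= k%:E)%E.
Proof.
move=> k0 fk; apply/ereal_supP => _ [x /= x1 <-]; rewrite lee_fin.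
by apply: le_trans (fk x) _; rewrite ler_piMr.
Qed.

Lemma le_dual_norm f x : x != 0 -> ((f x / `|x|)%:E <= dual_norm f)%E.
Proof.
move=> x0; have nx : 0 < `|x| by rewrite normr_gt0.
apply: (@le_trans _ _ (`|f (`|x|^-1 *: x)|)%:E).
  rewrite lee_fin dual_appZ mulrC; exact: ler_norm.
apply: ereal_sup_ubound; exists (`|x|^-1 *: x) => //=.
by rewrite normrZ normfV normr_id mulVf// gt_eqF.
Qed.

Lemma weak_star_eval_continuous x :
  continuous ((fun f => f x) : weak_star_dual X -> R).
Proof.
move=> f; pose ev (h : {ptws X -> R^o}) := h x.
have c1 := @initial_continuous _ _ (fun f : dual X => (f : {ptws X -> R^o})) f.
have c2 : {for (f : {ptws X -> R^o}), continuous ev}.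
  exact: (@proj_continuous _ (fun=> R^o) x).
exact: (continuous_comp c1 c2).
Qed.

(* The image of the ball under the evaluation embedding is closed in the
   product of the intervals [g x - k |x|, g x + k |x|]. *)
Lemma banach_alaoglu g (k : R) :
  compact ([set f : dual X | forall x, `|f x - g x| <= k * `|x|]
           : set (weak_star_dual X)).
Proof.
pose I x : set R^o := [set` `[g x - k * `|x|, g x + k * `|x|]].
have cI : compact ([set h | forall x, I x (h x)] : set {ptws X -> R^o}).
  by apply: tychonoff => x; exact: segment_compact.
pose coe f : {ptws X -> R^o} := f.
have inI f x : I x (f x) <-> `|f x - g x| <= k * `|x|.
  by rewrite /I/= in_itv/= ler_distl.
move=> F PF FB.
have GI : (coe @ F) [set h | forall x, I x (h x)].
  by rewrite /= nbhs_filterE; apply: filterS FB => f /= fB x; apply/inI.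
have [h [hI hF]] := cI (coe @ F) _ GI.
(* The cluster point [h] inherits linearity: the defect [E] is continuous and vanishes on all
   functionals, and its zero set is closed. *)
have lh : linear (h : X -> R^o).
  move=> a x y; apply/eqP; rewrite -subr_eq0; apply/eqP.
  pose E : {ptws X -> R^o} -> R^o := fun u => u (a *: x + y) - (a *: u x + u y).
  have cE : continuous E.
    have ev z : continuous (fun u : {ptws X -> R^o} => u z : R^o).
      exact: (@proj_continuous _ (fun=> R^o) z).
    move=> u; apply: (@cvgB _ R^o _ (nbhs u) _ (fun v => v (a *: x + y))
      (fun v => a *: v x + v y)); first exact: ev.
    apply: (@cvgD _ R^o _ (nbhs u) _ (fun v => a *: v x) (fun v => v y));
      last exact: ev.
    by apply: (@cvgZl_tmp _ R^o _ (nbhs u) _ a (fun v => v x)); exact: ev.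
  have clE : closed (E @^-1` [set 0]).
    by apply: (continuous_closedP E).1 => //; exact: closed_eq.
  apply: clE => B hB; apply: hF => //.
  by apply: (@filterE _ F) => f; rewrite /= /E /coe (linearP f) subrr.
have [c gc] := dual_bounded g.
have [f fh] : exists f : dual X, coe f = h.
  have [x|f fh] := @exists_dual h (k + c) lh; last by exists f; apply/funext.
  have := hI x; rewrite /I/= in_itv/= -ler_distl => hx.
  rewrite -[h x](subrK (g x)) mulrDl; apply: le_trans (ler_normD _ _) _.
  exact: lerD.
exists f; split.
  by move=> x; apply/inI; have := hI x; rewrite -fh.
(* The topology being initial, a neighbourhood of [f] contains the preimage of an open set around
   [h]. *)
move=> A B FA [_ [[U oU <-] Uf] UB].
have FA' : (coe @ F) (coe @` A).
  by rewrite /= nbhs_filterE; apply: filterS FA => u Au; exists u.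
have Uh : nbhs h U by apply: open_nbhs_nbhs; split; rewrite // -fh.
have [_ [[u Au <-] Uu]] := hF _ _ FA' Uh.
by exists u; split => //; exact: UB.
Qed.

End dual_theory.

(** * From the condition to regularity *)

Section regular_of_condition.
Variables (R : realType) (X : normedModType R) (T : X -> set (dual X)).

(** For [us] in [T x], monotonicity bounds [(xs - ys) (y - x)] by [(us - xs) (x - y)]. *)
Lemma monotone_gap_le_dist x xs : Defs.monotone T ->
  (monotone_gap x xs T <= dual_dist xs (T x))%E.
Proof.
move=> mT; apply/ereal_infP => _ [us Tus <-].
rewrite ge_max; apply/andP; split.
  apply: ereal_sup_ubound; exists 0; first by rewrite /= normr0.
  by rewrite dual_app0 normr0.
apply/ereal_supP => _ [[y ys] [Tys yx] <-].
have xy : x - y != 0 by rewrite subr_eq0 eq_sym.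
apply: le_trans (le_dual_norm (us - xs) xy).
rewrite lee_fin ler_wpM2r ?invr_ge0//.
have := mT _ _ _ _ Tus Tys.
by rewrite !dualB -(opprB x y) !dual_appN; lra.
Qed.

Lemma dist_le_monotone_gap x xs :
  (forall C : set (dual X), C !=set0 ->
     convex_set (C : set (convex_lmodType (dual X))) ->
     compact (C : set (weak_star_dual X)) ->
     (forall y ys, graph T (y, ys) ->
        exists2 cs : dual X, C cs & 0 <= (ys - cs) (y - x)) ->
     exists2 cs : dual X, C cs & T x cs) ->
  (dual_dist xs (T x) <= monotone_gap x xs T)%E.
Proof.
move=> hC; have : (0 <= monotone_gap x xs T)%E by rewrite le_max lexx.
case E : (monotone_gap x xs T) => [L||] //; first last.
  by move=> _; rewrite leey.
rewrite lee_fin => L0.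
have [||||c Cc Tc] := hC [set f | forall x, `|f x - xs x| <= L * `|x|].
- by exists xs => y /=; rewrite subrr normr0 mulr_ge0.
- move=> f g l /set_mem fL /set_mem gL; apply/mem_set => y /=.
  change (`|(l%:num *: f + (1 - l%:num) *: g : dual X) y - xs y| <= L * `|y|).
  rewrite dualD !dualZ.
  have -> : l%:num * f y + (1 - l%:num) * g y - xs y =
    l%:num * (f y - xs y) + (1 - l%:num) * (g y - xs y) by ring.
  have l0 : 0 <= l%:num by exact: ge0.
  have l1 : 0 <= 1 - l%:num by rewrite subr_ge0 le1.
  apply: le_trans (ler_normD _ _) _.
  rewrite !normrM (ger0_norm l0) (ger0_norm l1).
  have := ler_wpM2l l0 (fL y); have := ler_wpM2l l1 (gL y); lra.
- exact: banach_alaoglu.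
- move=> y ys Tys; have [b [bn by_]] := hahn_banach_support (y - x).
  (* Since [b] norms [y - x], this shift adds [L * |y - x|] to [(ys - xs) (y - x)], enough for a
     nonnegative value by definition of the gap. *)
  exists (xs - L *: b).
    move=> z; change (`|(xs - L *: b : dual X) z - xs z| <= L * `|z|).
    rewrite dualB dualZ addrAC subrr add0r normrN normrM.
    by rewrite ger0_norm// ler_wpM2l.
  rewrite !dualB dualZ by_; have [->|yx] := eqVneq y x.
    by rewrite subrr !dual_app0 normr0; lra.
  have : (((xs - ys) (y - x) / `|x - y|)%:E <= L%:E)%E.
    rewrite -E le_max; apply/orP; right; apply: ereal_sup_ubound.
    by exists (y, ys).
  rewrite lee_fin ler_pdivrMr ?normr_gt0 ?subr_eq0 1?eq_sym//.
  by rewrite dualB distrC; lra.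
apply: (@le_trans _ _ (dual_norm (c - xs))).
  by apply: ereal_inf_lbound; exists c.
exact: dual_norm_le.
Qed.

End regular_of_condition.

(** * A theorem of the alternative for finite affine systems *)

Section alternative.
Variables (R : realType) (X : normedModType R).

(** The left side is the squared distance from [b] to the nonnegative half-line, which contains
    [q]. *)
Lemma sqr_min0_le (a b q : R) : 0 <= q -> Num.min b 0 ^+ 2 <= (b - q) ^+ 2.
Proof.
move=> q0; have [b0|b0] := leP b 0; last by rewrite expr0n/= sqr_ge0.
by nra.
Qed.

(* The weights are the negative parts of the residuals [al i - c (v i)] at a
   point [c] of [C] minimising the sum of their squares. *)
Lemma affine_system_alternative (C : set (dual X)) (I : eqType) (s : seq I)
    (al : I -> R) (v : I -> X) :
  C !=set0 -> convex_set (C : set (convex_lmodType (dual X))) ->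
  compact (C : set (weak_star_dual X)) ->
  (exists2 c, C c & forall i, i \in s -> c (v i) <= al i) \/
  exists (p : I -> R) (e : R), [/\ forall i, 0 <= p i,
    \sum_(i <- s) p i = 1, 0 < e &
    forall c, C c -> \sum_(i <- s) p i * (al i - c (v i)) <= - e].
Proof.
move=> C0 convC cC.
pose phi (c : weak_star_dual X) : R :=
  \sum_(i <- s) Num.min (al i - (c : dual X) (v i)) 0 ^+ 2.
have cphi : continuous phi.
  apply: continuous_big.
    exact: (@pseudometric_normed_Zmodule.add_continuous R R^o).
  move=> i _ c; have ev := @weak_star_eval_continuous _ _ (v i) c.
  have res : {for c, continuous (fun f : weak_star_dual X =>
      al i - (f : dual X) (v i) : R^o)}.
    by apply: (@cvgB _ R^o _ (nbhs c) _ (fun=> al i)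
      (fun f : weak_star_dual X => (f : dual X) (v i))); [exact: cvg_cst|].
  have mn := continuous_min res (@cst_continuous _ _ (0 : R^o) c).
  exact: (cvgM mn mn).
have [c0 /set_mem Cc0 c0min] :
    exists2 c, c \in C & forall t, t \in C -> phi c <= phi t.
  apply: (@compact_EVT_min (weak_star_dual X) R phi C C0 cC).
  exact: continuous_subspaceT.
pose q i := - Num.min (al i - c0 (v i)) 0.
have q0 i : 0 <= q i by rewrite oppr_ge0 ge_min lexx orbT.
have phi0 : phi c0 = \sum_(i <- s) q i ^+ 2.
  by apply: eq_bigr => i _; rewrite sqrrN.
have qa i : q i * (al i - c0 (v i)) = - q i ^+ 2.
  by rewrite /q; case: leP => _; ring.
(* First-order optimality of [c0] along the segment towards [c]. *)
have var c : C c -> \sum_(i <- s) q i * (c0 (v i) - c (v i)) <= 0.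
  move=> Cc; set S := \sum_(i <- s) _.
  pose D := \sum_(i <- s) (c0 (v i) - c (v i)) ^+ 2.
  have D0 : 0 <= D by apply: sumr_ge0 => i _; exact: sqr_ge0.
  have h t : 0 < t -> t < 1 -> 2 * S <= t * D.
    move=> t0 t1.
    pose ct : dual X := t *: c + (1 - t) *: c0.
    have Cct : C ct.
      have := convC c c0 (Itv01 (ltW t0) (ltW t1)) (mem_set Cc) (mem_set Cc0).
      by move/set_mem.
    have := c0min _ (mem_set Cct); rewrite phi0 => le1.
    have le2 : phi ct <= \sum_(i <- s) (- q i + t * (c0 (v i) - c (v i))) ^+ 2.
      apply: ler_sum => i _.
      pose a := al i - c0 (v i).
      (* [a + q i] is the positive part of [a]; subtracting it bounds the truncated square by a
         polynomial in [t]. *)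
      have r0 : 0 <= a + q i by rewrite subr_ge0 ge_min lexx.
      have -> : al i - ct (v i) = a + t * (c0 (v i) - c (v i)).
        by rewrite dualD !dualZ /a; ring.
      have -> : - q i + t * (c0 (v i) - c (v i)) =
         a + t * (c0 (v i) - c (v i)) - (a + q i) by ring.
      exact: sqr_min0_le.
    have e2 : \sum_(i <- s) (- q i + t * (c0 (v i) - c (v i))) ^+ 2 =
        \sum_(i <- s) q i ^+ 2 - t * (2 * S - t * D).
      rewrite /S /D !mulr_sumr -sumrB mulr_sumr -sumrB.
      by apply: eq_bigr => i _; ring.
    move: (le_trans le1 le2); rewrite e2.
    rewrite -subr_ge0 addrAC subrr add0r oppr_ge0 pmulr_rle0// subr_le0//.
  rewrite leNgt; apply/negP => S0.
  (* Chosen so that [t * D <= S], against [2 * S <= t * D]; the denominator [D + 1] also covers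
     [D = 0]. *)
  pose t := Num.min (1/2) (S / (D + 1)).
  have t0 : 0 < t.
    by rewrite lt_min; apply/andP; split; [lra|apply: divr_gt0; lra].
  have t1 : t < 1 by rewrite gt_min; apply/orP; left; lra.
  have tS : t * D <= S.
    have : t <= S / (D + 1) by rewrite ge_min lexx orbT.
    rewrite ler_pdivlMr; last lra.
    nra.
  have := h t t0 t1; lra.
have [Q0|Qn0] := eqVneq (\sum_(i <- s) q i) 0.
  left; exists c0 => // i si.
  have : q i == 0.
    move/eqP: Q0; rewrite psumr_eq0//.
    by move=> /allP/(_ i si).
  rewrite oppr_eq0; case: (leP (al i - c0 (v i)) 0) => [_ /eqP|? _]; lra.
have Qgt0 : 0 < \sum_(i <- s) q i by rewrite lt_neqAle eq_sym Qn0 sumr_ge0.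
pose Q := \sum_(i <- s) q i.
have Q2gt0 : 0 < \sum_(i <- s) q i ^+ 2.
  rewrite lt_neqAle eq_sym sumr_ge0 ?andbT; last by move=> i _; exact: sqr_ge0.
  apply: contra_neq Qn0 => /eqP.
  rewrite psumr_eq0; last by move=> i _; exact: sqr_ge0.
  move=> /allP h; apply: big1_seq => i /= si.
  by apply/eqP; rewrite -sqrf_eq0; exact: h.
(* At [c0] the residuals weighted by [q] sum to [- \sum_(i <- s) q i ^+ 2]; by [var], any other [c]
   gives no larger sum. *)
right; exists (fun i => q i / Q), ((\sum_(i <- s) q i ^+ 2) / Q); split.
- by move=> i; rewrite divr_ge0// ltW.
- by rewrite -mulr_suml divff.
- exact: divr_gt0.
- move=> c Cc.
  have -> : \sum_(i <- s) q i / Q * (al i - c (v i)) =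
      (\sum_(i <- s) q i * (c0 (v i) - c (v i)) - \sum_(i <- s) q i ^+ 2) / Q.
    rewrite -sumrB mulr_suml; apply: eq_bigr => i _.
    by rewrite -qa; field.
  by rewrite -mulNr ler_pM2r ?invr_gt0// gerDr var.
Qed.

End alternative.

(** * From regularity to the condition: excluding separation *)

Section condition_of_regular.
Variables (R : realType) (X : normedModType R) (T : X -> set (dual X)).
Hypothesis regT : regular_multifunction T.

(** If [T x] is empty, the gap at [(x, 0)] is infinite. A graph point with quotient above
    [K + K / d] satisfies [(K + K / d) * |z - x| < K * (1 + |z - x|)], whence [|z - x| < d]. *)
Lemma regular_near_domain x (K d : R) : 0 < K -> 0 < d ->
  (forall z zs, T z zs -> - (K * (1 + `|z - x|)) <= zs (z - x)) ->
  exists z zs, [/\ T z zs, `|z - x| < d & zs (z - x) <= 0].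
Proof.
move=> K0 d0 hK; have [[xs Txs]|T0] := pselect (T x !=set0).
  by exists x, xs; rewrite subrr normr0 dual_app0.
have gapy : monotone_gap x 0 T = +oo%E.
  rewrite regT /dual_dist; move/set0P/negP/negPn/eqP: T0 => ->.
  by rewrite image_set0 ereal_inf0.
pose M := K + K / d.
have : (M%:E < monotone_gap x 0%R T)%E by rewrite gapy ltry.
have M0 : 0 < M by rewrite addr_gt0// divr_gt0.
have Mn0 : (M%:E < 0)%E = false by rewrite lte_fin ltNge ltW.
rewrite lt_max Mn0 => /ereal_sup_gt[_ [[z zs] [Tz zx] <-]].
rewrite lte_fin ltr_pdivlMr ?normr_gt0 ?subr_eq0 1?eq_sym// => hM.
have {}hM : M * `|z - x| < - zs (z - x).
 by move: hM; rewrite dualB distrC (_ : (0 : dual X) _ = 0)// sub0r.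
exists z, zs; split=> //; last first.
  have := mulr_ge0 (ltW M0) (normr_ge0 (z - x)); lra.
have := hK z zs Tz; move: hM; rewrite /M mulrDl mulrDr mulr1 => h1 h2.
have : K / d * `|z - x| < K by lra.
by rewrite mulrAC -mulrA gtr_pMr// ltr_pdivrMr// mul1r.
Qed.

Hypothesis monT : Defs.monotone T.
Variables (C : set (dual X)) (x0 : X) (k : R).
Hypothesis k0 : 0 < k.
Hypothesis Ck : forall c x, C c -> `|c x| <= k * `|x|.
Hypothesis hC : forall y ys, T y ys ->
  exists2 c : dual X, C c & 0 <= (ys - c) (y - x0).

(* The separating convex combination of points of the graph is contradicted by
   a point of the graph whose first component is close to [x0 + t *: yb], for
   small [t > 0], where [x0 + yb] is the barycentre. *)
Lemma graph_combination_not_separated (s : seq (X * dual X))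
    (p : X * dual X -> R) (e : R) :
  (forall i, i \in s -> T i.1 i.2) -> (forall i, 0 <= p i) ->
  \sum_(i <- s) p i = 1 -> 0 < e ->
  ~ (forall c, C c ->
       \sum_(i <- s) p i * (i.2 (i.1 - x0) - c (i.1 - x0)) <= - e).
Proof.
move=> Ts p0 p1 e0 hs.
pose yb := \sum_(i <- s) p i *: (i.1 - x0).
pose ysb : dual X := \sum_(i <- s) p i *: i.2.
pose A := \sum_(i <- s) p i * i.2 (i.1 - x0).
have sum_app (f : dual X) : \sum_(i <- s) p i * f (i.1 - x0) = f yb.
  rewrite /yb; elim: (s) => [|i r IH]; first by rewrite !big_nil dual_app0.
  by rewrite !big_cons IH [f (p i *: _ + _)]dual_appD dual_appZ.
have app_sum v : \sum_(i <- s) p i * i.2 v = ysb v.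
  rewrite /ysb; elim: (s) => [|i r IH]; first by rewrite !big_nil.
  by rewrite !big_cons IH dualD dualZ.
have hA c : C c -> A + e <= c yb.
  move=> /hs; under eq_bigr do rewrite mulrBr.
  by rewrite sumrB sum_app -/A; lra.
(* Monotonicity against each point of [s], averaged with the weights [p]. *)
have mon z zs : T z zs -> zs yb <= A - ysb (z - x0) + zs (z - x0).
  move=> Tz; have : 0 <= \sum_(i <- s) p i * (i.2 (i.1 - z) - zs (i.1 - z)).
    rewrite big_seq sumr_ge0// => i si; rewrite mulr_ge0//.
    exact: monT (Ts _ si) Tz.
  have -> : \sum_(i <- s) p i * (i.2 (i.1 - z) - zs (i.1 - z)) =
    \sum_(i <- s) p i * i.2 (i.1 - x0) - \sum_(i <- s) p i * i.2 (z - x0)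
    - \sum_(i <- s) p i * zs (i.1 - x0) + \sum_(i <- s) p i * zs (z - x0).
    rewrite -!sumrB -big_split/=; apply: eq_bigr => i _.
    by rewrite !dual_appB; ring.
  by rewrite sum_app app_sum -mulr_suml p1 mul1r -/A; lra.
have [l [l0 hl]] : exists l, 0 < l /\ forall v, `|ysb v| <= l * `|v|.
  have [l hl] := dual_bounded ysb; exists (`|l| + 1); split.
    by rewrite ltr_wpDl.
  move=> v; apply: le_trans (hl v) _; rewrite ler_wpM2r//.
  by have := ler_norm l; lra.
pose B := ysb yb; pose D := e + `|A| + `|B|.
have De : e <= D by rewrite /D -addrA lerDl addr_ge0.
have D0 : 0 < D by exact: lt_le_trans De.
(* The final estimate is [t * e <= t * (t * D) + (k + l) * d]; [t] and [d] make the two terms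
   [t * e / 2] and [t * e / 4]. *)
pose t := e / (2 * D).
have t0 : 0 < t by rewrite divr_gt0// mulr_gt0.
have tD : t * D = e / 2 by rewrite /t; field; rewrite gt_eqF.
have t1 : t <= 1 / 2 by rewrite ler_pdivrMr ?mulr_gt0//; lra.
pose d := t * e / (4 * (k + l)).
have kl0 : 0 < k + l by exact: addr_gt0.
have d0 : 0 < d by rewrite !(divr_gt0, mulr_gt0).
have dkl : d * (k + l) = t * e / 4 by rewrite /d; field; rewrite gt_eqF.
pose x := x0 + t *: yb.
(* Large enough for the growth bound of [regular_near_domain] at [x]: weigh [lower] by [1 - t] and
   [mon] by [t]. *)
pose K := (k + l) * (1 + `|yb|) + `|A| + 1.
have lower z zs : T z zs -> - k * `|z - x0| <= zs (z - x0).
  move=> Tz; have [c Cc] := hC Tz; rewrite dualB subr_ge0; apply: le_trans.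
  by rewrite mulNr; have := Ck (z - x0) Cc; rewrite ler_norml => /andP[].
have decomp z : z - x0 = t *: yb + (z - x).
  by apply/esym; rewrite addrC /x opprD addrA subrK.
have app_decomp (f : dual X) z : f (z - x0) = t * f yb + f (z - x).
  by rewrite decomp dual_appD dual_appZ.
have K0 : 0 < K.
  rewrite /K; have := normr_ge0 A; have : 0 <= (k + l) * (1 + `|yb|); last lra.
  by rewrite mulr_ge0 ?(ltW kl0)// addr_ge0.
have [z [zs [Tz zd zs0]]] :
    exists z zs, [/\ T z zs, `|z - x| < d & zs (z - x) <= 0].
  apply: (regular_near_domain K0 d0) => z zs Tz.
  have e1 : zs (z - x) = zs (z - x0) - t * zs yb.
    by rewrite app_decomp; ring.
  have h1 := lower _ _ Tz; have h2 := mon _ _ Tz.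
  have h3 : - (l * `|z - x0|) <= ysb (z - x0).
    by have := hl (z - x0); rewrite ler_norml => /andP[].
  have h4 : `|z - x0| <= `|yb| + `|z - x|.
    rewrite (decomp z); apply: le_trans (ler_normD _ _) _.
    rewrite lerD2r normrZ gtr0_norm// ler_piMl//; lra.
  have h5 := ler_norm A; have h6 := normr_ge0 A.
  have g1 : (1 - t) * (- k * `|z - x0|) <= (1 - t) * zs (z - x0).
    by rewrite ler_wpM2l//; lra.
  have g2 : t * zs yb <= t * (A - ysb (z - x0) + zs (z - x0)).
    by rewrite ler_wpM2l// ltW.
  have g3 : t * (A - ysb (z - x0)) <= t * (`|A| + l * `|z - x0|).
    by rewrite ler_wpM2l ?(ltW t0)//; lra.
  have kn : 0 <= k * `|z - x0| by rewrite mulr_ge0// ltW.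
  have ln : 0 <= l * `|z - x0| by rewrite mulr_ge0// ltW.
  have g4 : t * (k * `|z - x0|) >= 0 by rewrite mulr_ge0// ltW.
  have g5 : t * (`|A| + l * `|z - x0|) <= `|A| + l * `|z - x0|.
    by rewrite ler_piMl//; lra.
  have g6 : (k + l) * `|z - x0| <= (k + l) * (`|yb| + `|z - x|).
    by rewrite ler_wpM2l// ltW.
  have g7 : 0 <= (`|A| + 1) * `|z - x| by rewrite mulr_ge0//; lra.
  have g8 : 0 <= (k + l) * `|yb| * `|z - x|.
    by rewrite !mulr_ge0// ltW.
  rewrite e1 /K; lra.
have [c Cc] := hC Tz; rewrite dualB subr_ge0 => hc.
have wz := app_decomp zs z.
have cw := app_decomp c z.
have yw := app_decomp ysb z.
have m := mon _ _ Tz.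
have cA : t * (A + e) <= t * c yb by rewrite ler_wpM2l ?(ltW t0)// hA.
have cd : - (k * d) <= c (z - x).
  have := Ck (z - x) Cc; rewrite ler_norml => /andP[+ _].
  by apply: le_trans; rewrite lerN2 ler_wpM2l// ltW.
have ld : - (l * d) <= ysb (z - x).
  have := hl (z - x); rewrite ler_norml => /andP[+ _].
  by apply: le_trans; rewrite lerN2 ler_wpM2l// ltW.
(* Opposite bounds on [zs yb]: [low] from [C] and the separation, [up] from [mon]; both use
   [zs (z - x) <= 0]. *)
have low : t * (A + e) - k * d <= t * zs yb by lra.
have up : (1 - t) * zs yb <= A - t * B + l * d by lra.
have l1 : (1 - t) * (t * (A + e) - k * d) <= (1 - t) * (t * zs yb).
  by rewrite ler_wpM2l//; lra.
have u1 : t * ((1 - t) * zs yb) <= t * (A - t * B + l * d).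
  by rewrite ler_wpM2l// ltW.
have ABD : e + A - B <= D.
  by have := ler_norm A; have := ler_norm (- B); rewrite normrN /D; lra.
have tt : t * (t * (e + A - B)) <= t * (t * D).
  by rewrite !ler_wpM2l// ltW.
have kd : 0 <= t * (k * d).
  exact: mulr_ge0 (ltW t0) (mulr_ge0 (ltW k0) (ltW d0)).
have ldt : t * (l * d) <= l * d.
  by rewrite ler_piMl ?(mulr_ge0 (ltW l0) (ltW d0))//; lra.
have te : 0 < t * e by rewrite mulr_gt0.
rewrite tD in tt.
lra.
Qed.

End condition_of_regular.

(** * Norm bounds for weak-star compact sets *)

HB.instance Definition _ (R : realType) (X : normedModType R) :=
  isPointed.Build (weak_star_dual X) (0 : dual X).

(** Evaluations map [C] to compact, hence bounded, sets of reals, so Banach-Steinhaus applies. *)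
Lemma weak_star_compact_bounded (R : realType) (X : completeNormedModType R)
    (C : set (dual X)) : compact (C : set (weak_star_dual X)) ->
  exists2 k, 0 < k & forall (c : dual X) x, C c -> `|c x| <= k * `|x|.
Proof.
move=> cC; pose F := [set (c : X -> R^o) | c in C].
have linb f : F f -> bounded_fun_norm f /\ linear f.
  move=> [c Cc <-]; split; last exact: dual_linear.
  move=> r; have [k hk] := dual_bounded c; exists (`|k| * r) => x xr.
  apply: le_trans (hk x) _; apply: (@le_trans _ _ (`|k| * `|x|)).
    by rewrite ler_wpM2r// ler_norm.
  by rewrite ler_wpM2l.
have ptb : pointwise_bounded F.
  move=> x; have : compact
      ((fun c : weak_star_dual X => (c : dual X) x) @` C : set R^o).
    apply: (@continuous_compact (weak_star_dual X) R^o) cC.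
    apply: continuous_subspaceT; exact: weak_star_eval_continuous.
  move=> /compact_bounded[M [_ hM]]; exists (M + 1) => _ [c Cc <-].
  by apply: (hM (M + 1)); [rewrite ltrDl|exists c].
have [M hM] := Banach_Steinhauss linb ptb 1.
exists (`|M| + 1); first by rewrite ltr_wpDl.
move=> c x Cc; have [->|x0] := eqVneq x 0.
  by rewrite dual_app0 !normr0 mulr0.
have nx : 0 < `|x| by rewrite normr_gt0.
have := hM c _ (`|x|^-1 *: x); rewrite dual_appZ normrM normrZ.
rewrite normfV normr_id mulVf ?gt_eqF// => /(_ _ (lexx 1)) h.
rewrite -ler_pdivrMr// mulrC; apply: le_trans (h _) _; first by exists c.
by have := ler_norm M; lra.
Qed.

(** * The equivalence, by compactness and maximality *)

Theorem theorem4 (R : realType) (X : completeNormedModType R)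
    (T : X -> set (dual X)) :
  maximal_monotone T ->
  (regular_multifunction T <->
   forall (C : set (dual X)) (x0 : X),
     C !=set0 ->
     convex_set (C : set (convex_lmodType (dual X))) ->
     compact (C : set (weak_star_dual X)) ->
     (forall (y : X) (ys : dual X), graph T (y, ys) ->
        exists2 xs : dual X, C xs & 0 <= (ys - xs) (y - x0)) ->
     exists2 x0s : dual X, C x0s & T x0 x0s).
Proof.
move=> [monT maxT]; split; last first.
  move=> hC x xs; apply/eqP; rewrite eq_le monotone_gap_le_dist//=.
  by apply: dist_le_monotone_gap => C; exact: hC.
move=> regT C x0 C0 convC cC hC.
have [k k0 Ck] := weak_star_compact_bounded cC.
pose half (i : X * dual X) : set (weak_star_dual X) :=
  [set c | (c : dual X) (i.1 - x0) <= i.2 (i.1 - x0)].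
have clhalf i : closed (half i).
  have /continuous_closedP/(_ _ (@closed_le R (i.2 (i.1 - x0)))) :=
    @weak_star_eval_continuous _ _ (i.1 - x0).
  exact.
have clfam : closed_fam_of (C : set (weak_star_dual X)) (graph T)
    (fun i => C `&` half i).
  by exists half.
have fin : finI (graph T) (fun i => C `&` half i).
  move=> D' D'T.
  have [[c Cc hc]|[p [e [p0 p1 e0 he]]]] := affine_system_alternative
    (finmap.enum_fset D') (fun i => i.2 (i.1 - x0)) (fun i => i.1 - x0)
    C0 convC cC.
    by exists c => i /= iD; split=> //; exact: hc.
  exfalso.
  apply: (graph_combination_not_separated regT monT k0 Ck hC _ p0 p1 e0 he).
  by move=> [y ys] /D'T /set_mem.
(* Were the graph empty, a constant single-valued map would strictly extend it. A point of the graph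
   is what places the common point of the sets [C]&[half i] in [C]. *)
have Tne : exists i, graph T i.
  apply: contrapT => T0; case: C0 => c Cc.
  apply: maxT; exists (fun _ => [set c]); split.
    by move=> x xs y ys; rewrite /graph /= => -> ->; rewrite subrr.
  split; first by move=> i Ti; exfalso; apply: T0; exists i.
  by move=> h; apply: T0; exists (x0, c); apply: h.
have [c Cc hc] : exists2 c : dual X, C c &
    forall y ys, T y ys -> c (y - x0) <= ys (y - x0).
  move: cC; rewrite compact_In0 => /(_ _ _ _ clfam fin)[c hc].
  exists c; first by have [i Ti] := Tne; have [] := hc i Ti.
  by move=> y ys Ty; have [] := hc (y, ys) Ty.
(* Otherwise adding [(x0, c)] to the graph gives a strictly larger monotone one. *)
exists c => //; apply: contrapT => Tc; apply: maxT.
exists (fun x => [set xs | T x xs \/ (x = x0 /\ xs = c)]); split.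
  move=> x xs y ys; rewrite /graph /= => -[Tx|[-> ->]] [Ty|[-> ->]].
  - exact: monT.
  - by have := hc _ _ Tx; rewrite -subr_ge0.
  - suff : 0 <= c (x0 - y) - ys (x0 - y) by [].
    by rewrite -(opprB y x0) !dual_appN; have := hc _ _ Ty; lra.
  - by rewrite subrr.
split; first by move=> [x xs] Tx; left.
by move=> h; apply: Tc; apply: (h (x0, c)); right.
Qed.
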